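(* $\operatorname{asdim}\ell\text{-}\mathcal L(\mathbb Z)=\infty$.
   Context: A ballean is a triple $(X,P,B)$ where $X,P$ are sets, $P\ne\emptyset$, and $B\colon X\times P\to\mathcal P(X)$ satisfies: $x\in B(x,\alpha)$; $x\in B(y,\alpha)$ iff $y\in B(x,\alpha)$; and for all $\alpha,\beta\in P$ there is $\gamma\in P$ such that $B(B(x,\alpha),\beta)\subseteq B(x,\gamma)$ for every $x\in X$, where $B(A,\delta)=\bigcup_{y\in A}B(y,\delta)$. An extended metric (a metric allowed to take the value $\infty$) $d$ on $X$ induces the metric ballean $(X,\mathbb R_{\ge0},B_d)$, with $B_d(x,R)$ the closed ball of centre $x$ and radius $R$. A ballean $(X,P,B)$ has asymptotic dimension at most $n\in\mathbb N$ if for every $\alpha\in P$ there is a cover $\mathcal U=\mathcal U_0\cup\dots\cup\mathcal U_n$ of $X$ which is uniformly bounded (there is $\gamma\in P$ with $U\subseteq B(x,\gamma)$ for all $U\in\mathcal U$, $x\in U$) and such that for each $i$ and all distinct $U,V\in\mathcal U_i$ one has $B(U,\alpha)\cap V=\emptyset$. $\operatorname{asdim}$ is the least such $n$, and $\infty$ if there is none. For a group $G$, let $L(G)$ be the set of all subgroups of $G$. The subgroup logarithmic hyperballean $\ell\text{-}\mathcal L(G)$ is the metric ballean on $L(G)$ induced by the extended metric $d(H,K)=\log\max\{|H:H\cap K|,|K:H\cap K|\}$ if both indices are finite, and $d(H,K)=\infty$ otherwise (the base of the logarithm is any fixed real number $>1$). *)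

(* Defs.v *)
From HB Require Import structures.
From mathcomp Require Import all_boot all_order all_algebra finmap.
From mathcomp Require Import interval_inference.
From mathcomp Require Import all_classical all_reals exp.

Set Implicit Arguments.
Unset Strict Implicit.
Unset Printing Implicit Defensive.

Import Order.TTheory GRing.Theory Num.Theory.

Local Open Scope classical_set_scope.
Local Open Scope ring_scope.

Definition ball_of_set {X P : Type} (B : X -> P -> set X) (A : set X) (a : P)
  : set X := \bigcup_(y in A) B y a.

Record ballean := Ballean {
  ballean_point :> Type;
  ballean_radius : Type;
  bball : ballean_point -> ballean_radius -> set ballean_point;
  ballean_radius_inhabited : inhabited ballean_radius;
  bball_center : forall x a, bball x a x;
  bball_sym : forall x y a, bball y a x <-> bball x a y;
  bball_comp : forall a b, exists c, forall x,
    ball_of_set bball (bball x a) b `<=` bball x c }.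

Definition uniformly_bounded (X : ballean) (U : set (set X)) : Prop :=
  exists c : ballean_radius X,
    forall V, U V -> forall x, V x -> V `<=` bball x c.

Definition ball_separated (X : ballean) (a : ballean_radius X) (U : set (set X))
  : Prop :=
  forall V W, U V -> U W -> V <> W ->
    ball_of_set (@bball X) V a `&` W = set0.

Definition asdim_le (X : ballean) (n : nat) : Prop :=
  forall a : ballean_radius X, exists U : 'I_n.+1 -> set (set X),
    [/\ \bigcup_(V in \bigcup_i U i) V = [set: X],
        uniformly_bounded (\bigcup_i U i)
      & forall i, ball_separated a (U i)].

Definition asdim (X : ballean) : \bar nat :=
  match pselect (exists n, `[< asdim_le X n >]) with
  | left ex_n => (ex_minn ex_n)%:E%E
  | right _ => +oo%E
  end.

Record extended_metric (R : realType) (X : Type) (d : X -> X -> \bar R)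
  : Prop := ExtendedMetric {
  emetric_ge0 : forall x y, (0 <= d x y)%E;
  emetric_eq0 : forall x y, d x y = 0%E <-> x = y;
  emetric_sym : forall x y, d x y = d y x;
  emetric_triangle : forall x y z, (d x z <= d x y + d y z)%E }.

Section MetricBallean.
Variables (R : realType) (X : Type) (d : X -> X -> \bar R).
Hypothesis dM : extended_metric d.

Definition metric_ball (x : X) (r : {nonneg R}) : set X :=
  [set y | (d x y <= (r%:num)%:E)%E].

Fact metric_radius_inhabited : inhabited {nonneg R}.
Proof. exact: (inhabits 0%:nng). Qed.

Fact metric_ball_center x a : metric_ball x a x.
Proof. by rewrite /metric_ball /= (emetric_eq0 dM x x).2 // lee_fin. Qed.

Fact metric_ball_sym x y a : metric_ball y a x <-> metric_ball x a y.
Proof. by rewrite /metric_ball /= (emetric_sym dM). Qed.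

Fact metric_ball_comp a b : exists c, forall x,
  ball_of_set metric_ball (metric_ball x a) b `<=` metric_ball x c.
Proof.
exists (a%:num + b%:num)%:nng => x z [y /= xy yz].
apply: (le_trans (emetric_triangle dM x y z)).
by rewrite EFinD; apply: leeD.
Qed.

Definition metric_ballean : ballean :=
  Ballean metric_radius_inhabited metric_ball_center metric_ball_sym
    metric_ball_comp.

End MetricBallean.

Record subgroup (G : groupType) := Subgroup {
  subgroup_set :> set G;
  subgroup_closed : group_closed [in subgroup_set] }.

Section Index.
Variable G : groupType.
Implicit Types (H K L : subgroup G) (A B : set G).

Definition left_cosets A B : set (set G) :=
  [set [set (x * y)%g | y in B] | x in A].

Definition finite_index A B : Prop := finite_set (left_cosets A B).

(* The value 0 is used when the index is infinite. *)
Definition subgroup_index A B : nat := #|` fset_set (left_cosets A B)|.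

End Index.

Section SubgroupDistance.
Variables (R : realType) (b : R) (G : groupType).

Definition subgroup_dist (H K : subgroup G) : \bar R :=
  if `[< finite_index H (H `&` K) /\ finite_index K (H `&` K) >] then
    (ln (maxn (subgroup_index H (H `&` K)) (subgroup_index K (H `&` K)))%:R
       / ln b)%:E%E
  else +oo%E.

End SubgroupDistance.

Lemma leq_card_pair (T T1 T2 : choiceType) (A : set T) (B1 : set T1)
    (B2 : set T2) (f1 : T -> T1) (f2 : T -> T2) :
  finite_set B1 -> finite_set B2 ->
  (forall x, A x -> B1 (f1 x)) -> (forall x, A x -> B2 (f2 x)) ->
  (forall x y, A x -> A y -> f1 x = f1 y -> f2 x = f2 y -> x = y) ->
  finite_set A /\
  (#|` fset_set A| <= #|` fset_set B1| * #|` fset_set B2|)%N.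
Proof.
move=> fB1 fB2 f1P f2P f_inj; pose f x := (f1 x, f2 x).
have injf : {in A &, injective f}.
  by move=> x y; rewrite !inE => Ax Ay [E1 E2]; exact: f_inj.
have finA : finite_set A.
  rewrite -(eq_finite_set (inj_card_eq injf)).
  apply: (sub_finite_set _ (finite_setX fB1 fB2)) => _ [x Ax <-].
  by split; [exact: f1P|exact: f2P].
split=> //; rewrite -(size_map f) -(size_allpairs pair); apply: uniq_leq_size.
  rewrite map_inj_in_uniq ?fset_uniq// => x y.
  by rewrite !in_fset_set//; exact: injf.
move=> _ /mapP[x + ->]; rewrite in_fset_set// inE => Ax.
apply: allpairs_f; rewrite in_fset_set// inE; [exact: f1P|exact: f2P].
Qed.

Section SubgroupTheory.
Variable G : groupType.
Implicit Types (H K L : subgroup G).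

Lemma subg1 H : (H : set G) 1%g.
Proof. by case: H => A [/= + _]; rewrite inE. Qed.

Lemma subgV H x : (H : set G) x -> (H : set G) x^-1%g.
Proof.
case: H => A /= /group_closedV AV Ax.
by have := AV x; rewrite !inE; apply.
Qed.

Lemma subgM H x y : (H : set G) x -> (H : set G) y -> (H : set G) (x * y)%g.
Proof.
case: H => A /= /group_closedM AM Ax Ay.
by have := AM x y; rewrite !inE; apply.
Qed.

Lemma subgroup_inj H K : H = K :> set G -> H = K.
Proof.
case: H K => [A Ac] [B Bc] /= AB; rewrite -AB in Bc *.
by congr Subgroup; apply: Prop_irrelevance.
Qed.

Lemma lcoset_eq H K x y : (H : set G) x -> (H : set G) y ->
  [set (x * z)%g | z in H `&` K] = [set (y * z)%g | z in H `&` K] <->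
  (K : set G) (x^-1 * y)%g.
Proof.
move=> Hx Hy; split=> [E|Kxy].
  have : [set (x * z)%g | z in H `&` K] y.
    by rewrite E; exists 1%g; rewrite ?mulg1//; split; exact: subg1.
  by case=> z [_ Kz] <-; rewrite mulKg.
have Hxy : (H : set G) (x^-1 * y)%g by apply: subgM => //; exact: subgV.
apply/seteqP; split=> _ [z [Hz Kz] <-].
  exists ((x^-1 * y)^-1 * z)%g; last by rewrite invgM invgK -mulgA mulVKg.
  by split; apply: subgM => //; exact: subgV.
exists ((x^-1 * y) * z)%g; last by rewrite -mulgA mulVKg.
by split; apply: subgM.
Qed.

Lemma index_gt0 H K : finite_index H (H `&` K) ->
  (0 < subgroup_index H (H `&` K))%N.
Proof.
move=> fin; rewrite /subgroup_index cardfs_gt0; apply/fset0Pn.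
exists [set (1 * z)%g | z in H `&` K].
by rewrite in_fset_set// inE; exists 1%g => //; exact: subg1.
Qed.

Lemma index_eq1 H K : finite_index H (H `&` K) ->
  subgroup_index H (H `&` K) = 1%N <-> (H : set G) `<=` K.
Proof.
move=> fin; split=> [/eqP/cardfs1P[C CE] x Hx|HK].
  have inC y : (H : set G) y -> [set (y * z)%g | z in H `&` K] = C.
    move=> Hy; apply/eqP; rewrite -in_fset1 -CE in_fset_set// inE.
    by exists y.
  have := (inC _ (subg1 H)); rewrite -(inC _ Hx) => /lcoset_eq.
  by rewrite invg1 mul1g; apply => //; exact: subg1.
apply/eqP/cardfs1P; exists [set (1 * z)%g | z in H `&` K].
apply/fsetP => C; rewrite in_fset_set// in_fset1.
apply/idP/eqP; rewrite inE.
  move=> [x Hx <-]; apply/lcoset_eq => //; first exact: subg1.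
  by rewrite mulg1; apply/HK/subgV.
by move=> ->; exists 1%g => //; exact: subg1.
Qed.

Lemma index_trans H K L :
  finite_index H (H `&` K) -> finite_index K (K `&` L) ->
  finite_index H (H `&` L) /\
  (subgroup_index H (H `&` L) <=
   subgroup_index H (H `&` K) * subgroup_index K (K `&` L))%N.
Proof.
move=> finHK finKL.
pose rep A (C : set G) : G :=
  if pselect (exists2 x, (H : set G) x & [set (x * z)%g | z in H `&` A] = C)
  is left e then s2val (cid2 e) else 1%g.
have repP A C : left_cosets H (H `&` A) C ->
    (H : set G) (rep A C) /\ [set (rep A C * z)%g | z in H `&` A] = C.
  by rewrite /rep; case: pselect => // e _; case: cid2.
pose f1 C := [set (rep L C * z)%g | z in H `&` K].
pose k C : G := ((rep K (f1 C))^-1 * rep L C)%g.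
pose f2 C := [set (k C * z)%g | z in K `&` L].
have f1P C : left_cosets H (H `&` L) C -> left_cosets H (H `&` K) (f1 C).
  by move=> /repP[HC _]; exists (rep L C).
have kP C : left_cosets H (H `&` L) C -> (K : set G) (k C).
  move=> HC; have [H1 E1] := repP _ _ (f1P _ HC).
  by have [H2 E2] := repP _ _ HC; apply/(@lcoset_eq H).
apply: (@leq_card_pair _ _ _ _ _ _ f1 f2) => //.
  by move=> C /kP KC; exists (k C).
move=> C D HC HD E1 /lcoset_eq.
move=> /(_ (kP _ HC) (kP _ HD)).
rewrite /k E1 invgM invgK -mulgA mulVKg.
have [HC' EC] := repP _ _ HC; have [HD' ED] := repP _ _ HD => Lk.
by rewrite -EC -ED; apply/lcoset_eq.
Qed.

End SubgroupTheory.

Section SubgroupDistanceTheory.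
Variables (R : realType) (b : R) (G : groupType).
Hypothesis b_gt1 : 1 < b.

Fact subgroup_dist_metric : extended_metric (@subgroup_dist R b G).
Proof.
have lnb : 0 < ln b by rewrite ln_gt0.
have max_gt0 (H K : subgroup G) : finite_index H (H `&` K) ->
    (0 < maxn (subgroup_index H (H `&` K)) (subgroup_index K (H `&` K)))%N.
  by move=> fH; rewrite leq_max index_gt0.
split.
- move=> H K; rewrite /subgroup_dist; case: ifPn => // /asboolP[fH fK].
  by rewrite lee_fin divr_ge0 ?(ltW lnb)// ln_ge0 // ler1n; exact: max_gt0.
- move=> H K; rewrite /subgroup_dist; split.
    case: ifPn => // /asboolP[fH fK] [/eqP].
    rewrite mulf_eq0 invr_eq0 (gt_eqF lnb) orbF => /eqP ln0.
    have /eqP : (maxn (subgroup_index H (H `&` K)) (subgroup_index K (H `&` K)))%:R = 1 :> R.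
      by apply: (@ln_inj R); rewrite ?ln1// posrE ?ltr0n ?max_gt0.
    rewrite pnatr_eq1 => /eqP max1.
    have fK' := fK; rewrite setIC in fK'.
    apply: subgroup_inj; apply/seteqP; split.
      apply/index_eq1 => //; apply/eqP; rewrite eqn_leq index_gt0// andbT.
      by rewrite -max1 leq_maxl.
    apply/index_eq1 => //; apply/eqP; rewrite eqn_leq index_gt0// andbT.
    by rewrite -max1 setIC leq_maxr.
  move=> <-.
  have fin : finite_index H (H `&` H).
    apply: (sub_finite_set _ (finite_set1 [set (1 * z)%g | z in H `&` H])).
    move=> _ [x Hx <-]; apply/lcoset_eq => //; first exact: subg1.
    by rewrite mulg1; exact: subgV.
  rewrite asboolT// maxnn.
  have -> : subgroup_index H (H `&` H) = 1%N by apply/index_eq1.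
  by rewrite ln1 mul0r.
- move=> H K; rewrite /subgroup_dist setIC maxnC.
  by congr (if _ then _ else _); apply: asbool_equiv_eq; rewrite andC.
- move=> H K L; rewrite /subgroup_dist.
  case: (asboolP (_ /\ finite_index K (H `&` K))) => [[fH fK]|_]; last first.
    by rewrite addye ?leey//; case: ifPn.
  case: (asboolP (_ /\ finite_index L (K `&` L))) => [[gK gL]|_]; last first.
    by rewrite addey ?leey.
  have fK' := fK; rewrite setIC in fK'.
  have gL' := gL; rewrite setIC in gL'.
  have [fHL leHL] := index_trans fH gK.
  have [fLH leLH] := index_trans gL' fK'.
  rewrite asboolT; last by rewrite [X in finite_index L X]setIC.
  rewrite -EFinD lee_fin -mulrDl ler_wpM2r ?invr_ge0 ?(ltW lnb)//.
  rewrite -lnM ?posrE ?ltr0n ?max_gt0// ler_ln ?posrE ?mulr_gt0 ?ltr0n ?max_gt0//.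
  rewrite -natrM ler_nat geq_max; apply/andP; split.
    by rewrite (leq_trans leHL)// leq_mul// leq_maxl.
  rewrite setIC (leq_trans leLH)// mulnC [H `&` K]setIC [K `&` L]setIC.
  by rewrite leq_mul// leq_maxr.
Qed.

Definition log_hyperballean : ballean := metric_ballean subgroup_dist_metric.

End SubgroupDistanceTheory.

Arguments log_hyperballean {R b} G b_gt1.

(* Main.v *)
Require Import Defs.
From HB Require Import structures.
From mathcomp Require Import all_boot all_order all_algebra finmap.
From mathcomp Require Import interval_inference.
From mathcomp Require Import all_classical all_reals exp.
From mathcomp Require Import sequences zify ring.

Import Order.TTheory GRing.Theory Num.Theory.
Local Open Scope ring_scope.

(** The subgroups of Z generated by the numbers
      p_1 ^ x_1 * ... * p_m ^ x_m,
    for m distinct primes p_i, form a coarse copy of the orthant N^m in the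
    logarithmic hyperballean: the distance between two of them is small
    exactly when the exponent vectors are close.  Indeed the index of the
    intersection of aZ and cZ in aZ is at most q as soon as c divides a * q
    (q > 0), and conversely if it is at most D then c divides s * a for some
    0 < s <= D, which bounds every p_i-valuation of c by that of a plus D.
    As there are infinitely many primes, m may be any number, so it suffices
    that N^m has asymptotic dimension larger than n for m = n + 2.

    This is a covering-dimension argument.  Suppose that a uniformly bounded
    cover of N^m splits into n + 1 families whose members are far apart.  Give
    each member V a label, namely a coordinate i that is minimal among the
    coordinates of some chosen point of V.  Restrict to a huge simplex
    sum x_i <= M.  Scarf's lemma, a Sperner lemma in which the triangulation is
    replaced by m linear orders on the points, yields a set S of points whose
    coordinates vary by at most m and such that, J being the set of labels of
    S, the coordinates outside J are smaller than m on S, while some coordinate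
    i in J is large on S.  A point of S with label i has a large i-th
    coordinate, which is however its smallest one up to an error bounded by the
    size of the members of the cover; so no coordinate is small and J consists
    of all n + 2 labels.  Then S meets n + 2 members of the cover, two of which
    belong to the same family although they contain nearby points: a
    contradiction.

    Scarf's lemma is [scarf], its metric form is [small_rainbow_set], and the
    dimension estimate is [asdim_gt_of_coarse_embedding]. *)

(** * Scarf's lemma for linear orders with extreme points *)

Section Scarf.
Import boot.finset.
Local Open Scope nat_scope.

(** A map that is one step short of being injective on [D] glues exactly one
    pair of points, and these two are the points that may be dropped without
    changing the image.  This one fact gives both halves of the double count:
    it is used for the map sending an order to the lowest point of a door, and
    for the labelling of a room. *)
Lemma card_redundant (A B : finType) (h : A -> B) (D : {set A}) :
  #|D| = #|h @: D|.+1 -> #|[set y in D | h @: (D :\ y) == h @: D]| = 2.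
Proof.
move=> cardD.
have inj_redundant z : z \in D -> h @: (D :\ z) = h @: D ->
    {in D :\ z &, injective h}.
  move=> zD E; apply/imset_injP; rewrite E.
  by rewrite (cardsD1 z) zD add1n in cardD; case: cardD => ->.
have [x [y [xD yD xNy hxy]]] :
    exists x y, [/\ x \in D, y \in D, x != y & h x = h y].
  have : ~~ [forall x in D, forall y in D, (h x == h y) ==> (x == y)].
    apply/negP => /forall_inP h_inj.
    have /imset_injP/eqP : {in D &, injective h}.
      move=> x y xD yD /eqP hxy; apply/eqP.
      by move/forall_inP: (h_inj x xD) => /(_ y yD)/implyP/(_ hxy).
    by rewrite cardD => /esym/eqP; rewrite (gtn_eqF (ltnSn _)).
  case/forall_inPn => x xD /forall_inPn[y yD].
  by rewrite negb_imply => /andP[/eqP hxy xNy]; exists x, y.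
suff -> : [set y in D | h @: (D :\ y) == h @: D] = [set x; y].
  by rewrite cards2 xNy.
have redundant u v : u \in D -> v \in D -> u != v -> h u = h v ->
    h @: (D :\ u) == h @: D.
  move=> uD vD uNv huv; rewrite eqEsubset imsetS ?subsetDl//=.
  apply/fintype.subsetP => _ /imsetP[w wD ->].
  have [->|wNu] := eqVneq w u.
    by rewrite huv imset_f// !inE eq_sym uNv.
  by rewrite imset_f// !inE wNu.
apply/setP => z; rewrite !inE; apply/andP/orP => [[zD /eqP E]|].
  have [/eqP|zNx] := eqVneq z x; first by left.
  have [/eqP|zNy] := eqVneq z y; first by right.
  have := inj_redundant z zD E x y; rewrite !inE (eq_sym x) zNx (eq_sym y) zNy.
  by move=> /(_ xD yD hxy)/eqP; rewrite (negbTE xNy).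
case=> /eqP ->; split=> //; first exact: (redundant x y).
by apply: (redundant y x) => //; rewrite eq_sym.
Qed.

Variables (T I : finType) (f : I -> T -> nat).
Hypothesis f_inj : forall i, injective (f i).

(** These are the dominating sets of Scarf: no [y] is above the lowest points
    of [S] in all the orders at once.  An order is given by the injective key
    [f i]. *)
Definition dominant (S : {set T}) : bool :=
  [forall y, exists i, [forall (x | x \in S), f i y <= f i x]].

Lemma dominantP (S : {set T}) :
  reflect (forall y, exists i, forall x, x \in S -> f i y <= f i x)
          (dominant S).
Proof.
apply: (iffP forallP) => H y.
  by have /existsP[i /forall_inP] := H y; exists i.
by have [i /forall_inP] := H y; move=> ?; apply/existsP; exists i.
Qed.

Lemma dominantS (S S' : {set T}) :
  S' \subset S -> dominant S -> dominant S'.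
Proof.
move=> /fintype.subsetP S'S /dominantP H; apply/dominantP => y.
by have [i Hi] := H y; exists i => x /S'S; exact: Hi.
Qed.

(** By dominance every point of [S] is the lowest point [m i] of [S] for some
    order [i], and there is one more order than there are points, so exactly two
    orders [l] are redundant.  A point [y] that extends [S] must become the
    lowest point for one of these two, staying above the [m i] of all the other
    orders [i]; dominance of the extension then forces [y] to be the highest
    such point in the order [l].  This gives one extension for each redundant
    order, provided that the competition [Y l] is nonempty, which is the last
    hypothesis. *)
Lemma card_coface (S : {set T}) :
  dominant S -> 0 < #|S| -> #|I| = #|S|.+1 ->
  (forall l, exists y, forall i, i != l ->
     exists2 x, x \in S & f i x < f i y) ->
  #|[set y | (y \notin S) && dominant (y |: S)]| = 2.
Proof.
move=> domS /card_gt0P[x0 x0S] cardI Yex.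
pose m i := [arg min_(x < x0 in S) f i x].
have mS i : m i \in S by rewrite /m; case: arg_minnP.
have mP i x : x \in S -> f i (m i) <= f i x.
  by rewrite /m; case: arg_minnP => // y _; apply.
have m_onto : m @: setT = S.
  apply/eqP; rewrite eqEsubset; apply/andP; split; apply/fintype.subsetP.
    by move=> _ /imsetP[i _ ->].
  move=> x xS; have [i Hi] := dominantP _ domS x.
  apply/imsetP; exists i => //; apply: (f_inj i); apply/eqP.
  by rewrite eqn_leq Hi//= mP.
pose P := [set l in setT | m @: (setT :\ l) == m @: setT].
have cardP : #|P| = 2 by apply: card_redundant; rewrite m_onto cardsT.
have PE l : (l \in P) = (m @: (setT :\ l) == S) by rewrite !inE /= m_onto.
have m_inj l : l \in P -> {in setT :\ l &, injective m}.
  rewrite PE => /eqP E; apply/imset_injP; rewrite E.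
  have := cardsD1 l [set: I]; rewrite inE add1n cardsT cardI.
  by case=> ->.
pose Y l := [set y | [forall (i | i != l), f i (m i) < f i y]].
have YP l y : reflect (forall i, i != l -> f i (m i) < f i y) (y \in Y l).
  by rewrite inE; exact: forall_inP.
have Y_nonempty l : exists y, y \in Y l.
  have [y Hy] := Yex l; exists y; apply/YP => i /Hy[x xS].
  by apply: leq_ltn_trans; exact: mP.
pose top l := [arg max_(y > xchoose (Y_nonempty l) in Y l) f l y].
have topY l : top l \in Y l.
  by rewrite /top; case: arg_maxnP => //; exact: xchooseP.
have topP l y : y \in Y l -> f l y <= f l (top l).
  by rewrite /top; case: arg_maxnP; [exact: xchooseP|move=> z _; apply].
have Y_disj i j y : y \in Y i -> y \in Y j -> i = j.
  move=> /YP yi /YP yj; apply/eqP; apply/negPn/negP => iNj.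
  have [l Hl] := dominantP _ domS y.
  have := Hl _ (mS l); rewrite leqNgt => /negP; apply.
  have [->|] := eqVneq l i; first exact: yj.
  exact: yi.
suff -> : [set y | (y \notin S) && dominant (y |: S)] = top @: P.
  rewrite card_in_imset// => i j _ _ E.
  by apply: (Y_disj _ _ (top i)); rewrite ?topY// E topY.
apply/setP => y; rewrite inE; apply/andP/imsetP => [[yS domy]|[l lP ->{y}]].
  have [l Hl] := dominantP _ domy y.
  have fl_lt x : x \in S -> f l y < f l x.
    move=> xS; rewrite ltn_neqAle Hl ?inE ?xS ?orbT// andbT.
    by apply: contra yS => /eqP/f_inj ->.
  (* Every point of S keeps an order other than l in which it is lowest, so
     that l is redundant. *)
  have low x : x \in S -> exists i, [/\ i != l, m i = x & f i x <= f i y].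
    move=> xS; have [i Hi] := dominantP _ domy x.
    exists i; split.
    - apply: contraTneq (fl_lt _ xS) => <-.
      by rewrite -leqNgt Hi// !inE eqxx.
    - apply: (f_inj i); apply/eqP; rewrite eqn_leq mP// Hi// inE mS orbT//.
    - by rewrite Hi// !inE eqxx.
  have lP : l \in P.
    rewrite PE eqEsubset; apply/andP; split; apply/fintype.subsetP.
      by move=> _ /imsetP[i _ ->].
    move=> x /low[i [iNl <- _]]; by rewrite imset_f// !inE iNl.
  have yY : y \in Y l.
    apply/YP => i iNl; have [j [jNl jE]] := low _ (mS i).
    have -> : j = i by apply: (m_inj l lP); rewrite ?inE ?jNl ?iNl.
    rewrite leq_eqVlt => /predU1P[/f_inj E|//].
    by rewrite -E mS in yS.
  exists l => //; apply: (f_inj l); apply/eqP; rewrite eqn_leq topP//=.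
  have [i Hi] := dominantP _ domy (top l).
  have [il|iNl] := eqVneq i l.
    by rewrite il in Hi; rewrite Hi// !inE eqxx.
  have /YP/(_ i iNl) := topY l; rewrite ltnNge => /negP[].
  by rewrite Hi// inE mS orbT.
have /YP Hy := topY l.
split.
  apply/negP; have := lP; rewrite PE => /eqP {1}<-.
  case/imsetP => i; rewrite !inE andbT => /Hy + E.
  by rewrite E ltnn.
apply/dominantP => z.
(* Points of [Y l] are beaten in the order l by the choice of [top l]; any
   other z is already below some [m i] with i != l, hence below [top l]. *)
have [zY|zNY] := boolP (z \in Y l).
  have [i Hi] := dominantP _ domS z.
  have il : i = l.
    apply: contraTeq (Hi _ (mS i)) => iNl; rewrite -ltnNge.
    by move/YP: zY; apply.
  exists i => x; rewrite !inE => /predU1P[->|]; last exact: Hi.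
  by rewrite il topP.
have : ~~ [forall (i | i != l), f i (m i) < f i z] by move: zNY; rewrite inE.
case/forall_inPn => i iNl; rewrite -leqNgt => Hz.
exists i => x; rewrite !inE => /predU1P[->|xS].
  by apply: (leq_trans Hz); apply: ltnW; exact: Hy.
by apply: (leq_trans Hz); exact: mP.
Qed.

(** The extreme points [e i] play the part of the faces of a triangulated
    simplex: [e i] is lowest in the order [i] and above all ordinary points in
    the other orders. *)
Section Sperner.
Variables (e : I -> T) (c : T -> I) (i0 : I).
Hypothesis ce : forall i, c (e i) = i.
Hypothesis e_min : forall i x, f i (e i) <= f i x.
Hypothesis e_max :
  forall i j x, j != i -> x \notin codom e -> f i x < f i (e j).
Hypothesis I_gt1 : 1 < #|I|.

Let e_inj : injective e.
Proof. exact: can_inj ce. Qed.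

(** Rooms and doors are the facets and ridges in the usual proof of Sperner's
    lemma; only the ridges with all labels except [i0] matter. *)
Definition door (S : {set T}) : bool :=
  [&& dominant S, #|I| == #|S|.+1 & c @: S == [set~ i0]].
Definition room (A : {set T}) : bool := dominant A && (#|A| == #|I|).
Definition outer_door : {set T} := e @: [set~ i0].

Lemma outer_door_door : door outer_door.
Proof.
apply/and3P; split.
- apply/dominantP => y; have [/codomP[i ->]|yN] := boolP (y \in codom e).
    by exists i => x _; exact: e_min.
  exists i0 => _ /imsetP[j +->]; rewrite !inE => jN.
  by apply: ltnW; exact: e_max.
- rewrite card_imset// -cardsT (cardsD1 i0) inE add1n eqSS.
  by apply/eqP; apply: eq_card => i; rewrite !inE andbT.
- rewrite -imset_comp (@eq_imset _ _ _ id) ?imset_id// => i /=; exact: ce.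
Qed.

(** The only extension is by the highest point outside the door in the order
    [i0]: in every other order the door contains the extreme point, so that a
    new point cannot be the lowest one. *)
Lemma card_coface_outer :
  #|[set y | (y \notin outer_door) && dominant (y |: outer_door)]| = 1.
Proof.
have e0N : e i0 \in ~: outer_door.
  rewrite inE; apply/imsetP => -[j]; rewrite !inE => + /e_inj E.
  by rewrite -E eqxx.
apply/eqP/cards1P.
exists [arg max_(y > e i0 in ~: outer_door) f i0 y]; case: arg_maxnP => // t.
rewrite inE => tN t_max.
have tmax z : z \notin outer_door -> f i0 z <= f i0 t.
  by move=> zN; apply: t_max; rewrite inE.
apply/setP => y; rewrite !inE.
apply/andP/eqP => [[yN domy]|->].
  apply: (f_inj i0); apply/eqP; rewrite eqn_leq tmax//=.
  have [i Hi] := dominantP _ domy t.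
  have [<-|iN] := eqVneq i i0; first by rewrite Hi// !inE eqxx.
  have : f i t <= f i (e i) by rewrite Hi// !inE imset_f ?orbT// !inE.
  rewrite leqNgt ltn_neqAle e_min andbT negbK => /eqP/f_inj E.
  by case/negP: tN; rewrite -E imset_f// !inE.
split=> //; apply/dominantP => z.
have [/imsetP[j _ ->]|zN] := boolP (z \in outer_door).
  by exists j => x _; exact: e_min.
exists i0 => x; rewrite !inE => /predU1P[->|]; first exact: tmax.
case/imsetP => j; rewrite !inE => jN ->.
have [/codomP[k E]|zNe] := boolP (z \in codom e); last first.
  by apply: ltnW; exact: e_max.
suff k0 : k = i0 by rewrite E k0 e_min.
by apply: contraNeq zN => kN; rewrite E imset_f// !inE.
Qed.

(** The extreme point [e l] witnesses that [Y l] is nonempty, unless the lowest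
    point of [S] for some order [i] is an extreme point other than [e i]; in
    that case [S] consists of all the extreme points except [e i], and its
    labels show that [i] is [i0]. *)
Lemma card_coface_inner (S : {set T}) : door S -> S != outer_door ->
  #|[set y | (y \notin S) && dominant (y |: S)]| = 2.
Proof.
move=> /and3P[domS /eqP cardI /eqP cS] SN.
apply: card_coface => //; first by rewrite -ltnS -cardI.
move=> l; exists (e l) => i iNl.
have [H|] := boolP [exists x in S, (x \notin codom e) || (x == e i)].
  case/exists_inP: H => x xS /orP[xN|/eqP xE]; exists x => //.
    by apply: e_max; rewrite // eq_sym.
  rewrite xE ltn_neqAle e_min andbT; apply: contra iNl.
  by move=> /eqP/f_inj/e_inj ->.
move=> /exists_inPn H.
have Se : S \subset e @: [set~ i].
  apply/fintype.subsetP => x /H; rewrite negb_or negbK.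
  case/andP=> /codomP[j ->] jN; rewrite imset_f// !inE.
  by apply: contra jN => /eqP ->.
have SE : S = e @: [set~ i].
  apply/eqP; rewrite eqEcard Se card_imset//.
  have := cardsD1 i [set: I]; rewrite inE add1n cardsT cardI => -[->].
  by apply: subset_leq_card; apply/fintype.subsetP => j; rewrite !inE andbT.
have cS' : c @: S = [set~ i].
  by rewrite SE -imset_comp (@eq_imset _ _ _ id) ?imset_id//;
    move=> j /=; exact: ce.
case/negP: SN; rewrite SE /outer_door.
suff -> : i = i0 by [].
by move: cS'; rewrite cS => /setP/(_ i); rewrite !inE eqxx => /negbFE/eqP.
Qed.

(** If such a room has a door at all, then its labels are those of the door,
    so exactly one label is repeated and dropping either of its two bearers
    leaves a door. *)
Lemma doors_even (A : {set T}) : room A -> c @: A != setT ->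
  ~~ odd #|[set y in A | door (A :\ y)]|.
Proof.
move=> /andP[domA /eqP cardA] cA.
have [->|] := eqVneq [set y in A | door (A :\ y)] set0; first by rewrite cards0.
case/set0Pn => y0; rewrite !inE => /andP[y0A /and3P[_ _ /eqP cy0]].
have cAE : c @: A = [set~ i0].
  apply/eqP; rewrite eqEsubset -{2}cy0 imsetS ?subsetDl// andbT.
  apply/fintype.subsetP => _ /imsetP[y yA ->]; rewrite !inE.
  apply: contraNneq cA => cy; rewrite eqEsubset finset.subsetT /=.
  apply/fintype.subsetP => i _; have [->|iN] := eqVneq i i0.
    by rewrite -cy imset_f.
  have : i \in c @: (A :\ y0) by rewrite cy0 !inE.
  by case/imsetP => z; rewrite !inE => /andP[_ zA] ->; rewrite imset_f.
have cardA' y : y \in A -> #|I| == #|A :\ y|.+1.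
  by move=> yA; rewrite -cardA (cardsD1 y) yA.
suff -> : [set y in A | door (A :\ y)] = [set y in A | c @: (A :\ y) == c @: A].
  rewrite card_redundant// cAE cardA -cardsT (cardsD1 i0) inE add1n.
  by congr _.+1; apply: eq_card => i; rewrite !inE andbT.
apply/setP => y; rewrite !inE cAE; case: (boolP (y \in A)) => //= yA.
by rewrite /door cardA'// (dominantS _ _ _ domA) ?subsetDl.
Qed.

(** Both sides count the pairs consisting of a door and a room that contains
    it, encoded by the door or the room together with the extra point. *)
Lemma incidence_count :
  \sum_(S | door S) #|[set y | (y \notin S) && dominant (y |: S)]| =
  \sum_(A | room A) #|[set y in A | door (A :\ y)]|.
Proof.
pose incident S y := [&& door S, y \notin S & dominant (y |: S)].
transitivity (\sum_(y : T) \sum_(S | incident S y) 1).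
  rewrite (exchange_big_dep door)/=; last by move=> y S _ /and3P[].
  apply: eq_bigr => S dS; rewrite -sum1_card; apply: eq_bigl => y.
  by rewrite !inE /incident dS.
rewrite [RHS](eq_bigr (fun A : {set T} => \sum_(y in A | door (A :\ y)) 1));
  last first.
  by move=> A _; rewrite -sum1_card; apply: eq_bigl => y; rewrite inE.
rewrite [RHS](exchange_big_dep predT)//=; apply: eq_bigr => y _.
rewrite (reindex_onto (fun A : {set T} => A :\ y)
  (fun S : {set T} => y |: S)) /=; last first.
  by move=> S /and3P[_ yS _]; rewrite setU1K.
apply: eq_bigl => A; rewrite /incident !inE eqxx /=.
have [yA|yA] := boolP (y \in A); last first.
  rewrite andbF; apply/negbTE; apply: contra yA => /andP[_ /eqP <-].
  by rewrite !inE eqxx.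
rewrite setD1K// eqxx andbT /room /=.
have [/and3P[_ /eqP E _]|] := boolP (door (A :\ y)); last by rewrite !andbF.
by rewrite E (cardsD1 y A) yA add1n eqxx !andbT.
Qed.

(** Counting from the doors, the number of incidences is odd because of the
    outer door; counting from the rooms it would be even if no room had all the
    labels. *)
Lemma exists_rainbow_room : exists2 A, room A & c @: A = setT.
Proof.
have [/exists_inP[A rA /eqP cA]|/exists_inPn noA] :=
  boolP [exists (A | room A), c @: A == setT]; first by exists A.
have := congr1 odd incidence_count.
rewrite (bigD1 outer_door) ?outer_door_door//= card_coface_outer.
rewrite (eq_bigr (fun=> 2)) => [|S /andP[dS SN]]; last exact: card_coface_inner.
rewrite sum_nat_const oddD oddM andbF /=.
rewrite (big_morph odd oddD (erefl _)) big1// => A rA.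
by apply/negbTE/doors_even => //; exact: noA.
Qed.

End Sperner.
End Scarf.

(** * Small sets with many labels in a simplex *)

Section ScarfSelection.
Import boot.finset.
Local Open Scope nat_scope.

(** Scarf's lemma for arbitrary functions [g i].  Ties are broken by an
    enumeration of [X], and one extreme point with label [i] is added for each
    [i].  In a rainbow room, the labels of the ordinary points include every
    index whose extreme point is absent; an order that witnesses dominance over
    an ordinary point is such an index, because the extreme point of that order
    would be strictly below. *)
Lemma scarf {X I : finType} (g : I -> X -> nat) (c : X -> I) : 1 < #|I| ->
  exists S : {set X}, forall y, exists2 i, i \in c @: S &
    forall x, x \in S -> g i y <= g i x.
Proof.
move=> I_gt1; have /card_gt0P[i0 _] := ltnW I_gt1.
pose N := #|X|.+1.
(* Lexicographic order on (g i x, rank of x); the successor keeps the key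
   positive, leaving 0 for the extreme point. *)
pose key i (x : X) := (g i x).+1 * N + enum_rank x.
pose f i (t : I + X) := match t with
  | inl j => if j == i then 0 else (\max_x key i x).+1 + enum_rank j
  | inr x => key i x
  end.
pose c' (t : I + X) := match t with inl j => j | inr x => c x end.
have key_gt0 i x : 0 < key i x by [].
have key_max i x : key i x <= \max_x key i x by exact: leq_bigmax.
have rankN (x : X) : enum_rank x < N by rewrite ltnS ltnW.
have key_inj i : injective (key i).
  move=> x y; rewrite /key => /(congr1 (modn^~ N)).
  by rewrite !modnMDl !modn_small// => /val_inj/enum_rank_inj.
have f_inj i : injective (f i).
  move=> [j|x] [k|y] /=.
  - case: eqP => [->|_]; case: eqP => [->|_] //.
    by move/addnI/val_inj/enum_rank_inj ->.
  - case: eqP => [_ E|_ E]; first by have := key_gt0 i y; rewrite -E.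
    by have := key_max i y; rewrite -E; lia.
  - case: eqP => [_ E|_ E]; first by have := key_gt0 i x; rewrite E.
    by have := key_max i x; rewrite E; lia.
  - by move/key_inj ->.
have [||A /andP[/dominantP domA _] cA] :=
    @exists_rainbow_room _ _ f f_inj inl c' i0 (fun=> erefl) _ _ I_gt1.
- by move=> i t; rewrite /f eqxx.
- move=> i j [k|x] /negbTE jN; first by rewrite codom_f.
  by move=> _ /=; rewrite jN; have := key_max i x; lia.
exists [set x | inr x \in A] => y; have [i Hi] := domA (inr y).
exists i.
  have : i \in c' @: A by rewrite cA.
  case/imsetP => -[j|x] tA /= E; last by rewrite E imset_f// inE.
  by have := Hi _ tA; rewrite /f /= E eqxx leqNgt key_gt0.
move=> x; rewrite inE => /Hi /=; rewrite /key.
have := rankN x; move: (enum_rank x : nat) (enum_rank y : nat) => r r'.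
by clear; nia.
Qed.

Definition simplex (I : finType) (M : nat) :=
  {x : {ffun I -> 'I_M.+1} | \sum_i x i <= M}.

Definition coord {I : finType} {M : nat} (x : simplex I M) (i : I) : nat :=
  val x i.

(** Let [a i] be the minimum of the [i]-th coordinate on the set given by
    Scarf's lemma, and [J] its set of labels.  If the numbers [a i + 1], for [i]
    in [J], had a sum at most [M], they would be the coordinates of a point
    strictly above all these minima.  So the sum of the [a i] over [J] exceeds
    [M - #|J|], and since the coordinates of every point add up to at most [M],
    each of them is pinned down up to an error less than [#|J|]: to [a i] inside
    [J] and to 0 outside.  The same sum being large, some [a i] is large. *)
Lemma small_rainbow_set (I : finType) (M B : nat) (c : simplex I M -> I) :
  1 < #|I| -> #|I| * B <= M -> exists S : {set simplex I M},
  [/\ forall x z i, x \in S -> z \in S -> coord x i <= coord z i + #|I|,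
      forall x j, x \in S -> j \notin c @: S -> coord x j < #|I|
    & exists2 i, i \in c @: S & forall x, x \in S -> B <= coord x i].
Proof.
move=> I_gt1 leM.
have [S domS] := scarf (fun i x => coord x i) c I_gt1.
have mk (y : I -> nat) : \sum_i y i <= M ->
    exists x : simplex I M, coord x =1 y.
  move=> yM; have yiM i : y i < M.+1.
    by rewrite ltnS (leq_trans _ yM)// (bigD1 i)//= leq_addr.
  pose u : {ffun I -> 'I_M.+1} := [ffun i => Ordinal (yiM i)].
  have E : \sum_i u i <= M.
    by rewrite (eq_bigr y)// => i _; rewrite ffunE.
  by exists (exist _ u E) => i; rewrite /coord /= ffunE.
have [|z0 _] := mk (fun=> 0); first by rewrite big1.
have [_ /imsetP[x0 x0S _] _] := domS z0.
have [a a_min aP] : exists2 a : I -> nat,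
    forall i, exists2 x, x \in S & a i = coord x i &
    forall i x, x \in S -> a i <= coord x i.
  exists (fun i => coord [arg min_(x < x0 in S) coord x i] i) => i;
    case: arg_minnP => //= x xS; first by exists x.
have sum_gt : M < \sum_(i in c @: S) (a i).+1.
  rewrite ltnNge; apply/negP => sumM.
  have [|y yE] := mk (fun i => if i \in c @: S then (a i).+1 else 0).
    by rewrite -big_mkcond.
  have [i iI Hi] := domS y; have [x xS ax] := a_min i.
  by have := Hi _ xS; rewrite yE iI ax ltnn.
have sum_gt' : M < \sum_(i in c @: S) a i + #|c @: S|.
  rewrite -sum1_card -big_split /=; apply: (leq_trans sum_gt).
  by apply: leq_sum => i _; rewrite addn1.
have leI : #|c @: S| <= #|I| by exact: max_card.
have sum_coord (x : simplex I M) : \sum_i coord x i <= M := valP x.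
have in_bound (x : simplex I M) i :
    x \in S -> i \in c @: S -> coord x i < a i + #|I|.
  move=> xS iI; have := sum_coord x; rewrite (bigID (fun i => i \in c @: S))/=.
  rewrite (bigD1 i)//= => le1.
  have le2 : \sum_(j in c @: S | j != i) a j <=
             \sum_(j in c @: S | j != i) coord x j.
    by apply: leq_sum => j _; exact: aP.
  by move: sum_gt' leI le1 le2; rewrite (bigD1 i)//=; clear; lia.
have out_bound (x : simplex I M) j :
    x \in S -> j \notin c @: S -> coord x j < #|I|.
  move=> xS jI; have := sum_coord x; rewrite (bigID (fun i => i \in c @: S))/=.
  rewrite [X in _ + X](bigD1 j)//= => le1.
  have le2 : \sum_(i in c @: S) a i <= \sum_(i in c @: S) coord x i.
    by apply: leq_sum => i _; exact: aP.
  rewrite -(ltn_add2l (\sum_(i in c @: S) a i)).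
  apply: (@leq_ltn_trans M); last by rewrite (leq_trans sum_gt')// leq_add2l.
  by apply: leq_trans le1; rewrite leq_add// leq_addr.
exists S; split=> [x z i xS zS||].
- have [iI|iI] := boolP (i \in c @: S).
    by have := in_bound x i xS iI; have := aP i z zS; lia.
  by have := out_bound x i xS iI; lia.
- exact: out_bound.
- have [/exists_inP[i iI Ba]|/exists_inPn noB] :=
    boolP [exists (i | i \in c @: S), B <= a i].
    by exists i => // x xS; rewrite (leq_trans Ba)// aP.
  have : \sum_(i in c @: S) (a i).+1 <= \sum_(i in c @: S) B.
    by apply: leq_sum => i /noB; rewrite -ltnNge.
  rewrite sum_nat_const => le1; move: sum_gt; rewrite ltnNge.
  by rewrite (leq_trans le1)// (leq_trans _ leM)// leq_mul2r leI orbT.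
Qed.
End ScarfSelection.

(** * Coarse copies of an orthant have large asymptotic dimension *)

Section CoarseSimplices.
Import boot.finset.
Local Open Scope nat_scope.

(** The hypotheses say that [phi] is a coarse embedding of the orthant with
    [n + 2] coordinates.  The orthant has asymptotic dimension [n + 2], but the
    weaker bound allows the simplex to be cut out by one inequality, with all
    the coordinates on the same footing. *)
Lemma asdim_gt_of_coarse_embedding (X : ballean) (n : nat)
    (phi : ('I_n.+2 -> nat) -> X) :
  (forall k, exists a, forall x z, (forall i, x i <= z i + k) ->
     (forall i, z i <= x i + k) -> bball (phi x) a (phi z)) ->
  (forall a, exists D, forall x z, bball (phi x) a (phi z) ->
     forall i, x i <= z i + D) ->
  ~ asdim_le X n.
Proof.
move=> phi_bornologous phi_proper asdimX.
pose I := 'I_n.+2.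
have [a ballA] := phi_bornologous #|I|.
have [U [covU [g bddU] sepU]] := asdimX a.
have [D ballD] := phi_proper g.
(* A point having some coordinate smaller than #|I| has the coordinate of its
   label smaller than #|I| + D.*2, by [c_small] below; M is large enough for
   [small_rainbow_set] to contradict this. *)
pose M := #|I| * (#|I| + D.*2).
have covered (x : simplex I M) : exists tV : 'I_n.+1 * set X,
    U tV.1 tV.2 /\ tV.2 (phi (coord x)).
  have : (\bigcup_(V in \bigcup_i U i) V)%classic (phi (coord x)).
    by rewrite covU.
  by case=> V [t _ UV] Vx; exists (t, V).
have [tV tVP] := choice covered.
(* The label depends on the member V only, not on the point that V covers: in
   the end, distinct labels will have to come from distinct members. *)
have label_ex (V : set X) : exists i,
    (exists z : simplex I M, V (phi (coord z))) ->
    exists z : simplex I M,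
      V (phi (coord z)) /\ forall j, coord z i <= coord z j.
  have [[z Vz]|noz] := pselect (exists z : simplex I M, V (phi (coord z)));
    last by exists ord0.
  exists [arg min_(i < ord0) coord z i] => _; exists z; split=> //.
  by case: arg_minnP => // i _ imin j; exact: imin.
have [label labelP] := choice label_ex.
pose c x := label (tV x).2.
(* The coordinates of the chosen point of V differ from those of x by at most
   D; hence twice D. *)
have c_small x j : coord x (c x) <= coord x j + D.*2.
  have [Ux Vx] := tVP x.
  have [|z [Vz zmin]] := labelP (tV x).2; first by exists x.
  have xz : bball (phi (coord x)) g (phi (coord z)).
    by apply: (bddU (tV x).2) => //; exists (tV x).1.
  have zx : bball (phi (coord z)) g (phi (coord x)) by apply/bball_sym.
  have := ballD _ _ xz (c x); have := ballD _ _ zx j; have := zmin j.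
  by rewrite -/(c x); lia.
have [S [S_small S_out [i iS S_in]]] :
  exists S : {set simplex I M},
  [/\ forall x z i, x \in S -> z \in S -> coord x i <= coord z i + #|I|,
      forall x j, x \in S -> j \notin c @: S -> coord x j < #|I|
    & exists2 i, i \in c @: S & forall x, x \in S -> #|I| + D.*2 <= coord x i].
  by apply: small_rainbow_set => //; rewrite card_ord.
have all_labels j : j \in c @: S.
  apply/negPn/negP => jS; have /imsetP[x xS ix] := iS.
  have := S_in _ xS; have := S_out _ _ xS jS; have := c_small x j.
  by rewrite -ix; lia.
have label_pt j : exists x, x \in S /\ c x = j.
  by have /imsetP[x xS ->] := all_labels j; exists x.
have [y yP] := choice label_pt.
have /injectivePn[j [j' jNj' colE]] : ~~ injectiveb (fun j => (tV (y j)).1).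
  by apply/injectiveP => /leq_card; rewrite !card_ord ltnn.
have VN : (tV (y j)).2 <> (tV (y j')).2.
  move=> E; case/eqP: jNj'.
  by rewrite -(proj2 (yP j)) -(proj2 (yP j')) /c E.
have [[jS _] [j'S _]] := (yP j, yP j').
have [[Uj Vj] [Uj' Vj']] := (tVP (y j), tVP (y j')).
rewrite -colE in Uj'.
suff : (classical_sets.set0 : set X) (phi (coord (y j'))) by [].
rewrite -(sepU _ _ _ Uj Uj' VN); split=> //.
by exists (phi (coord (y j))) => //; apply: ballA => i'; exact: S_small.
Qed.
End CoarseSimplices.

(** * Indices of intersections of subgroups of the integers *)

Section IntegerSubgroups.
Local Open Scope classical_set_scope.
Notation Z := (GRing.to_multiplicative int).

Lemma multiples_closed (n : nat) :
  group_closed [in [set x : Z | (n %| (x : int))%Z]].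
Proof.
split=> [|x y]; first by rewrite inE /= dvdz0.
rewrite !inE /= => nx ny.
have nxy : ((x : int) - (y : int))%R \in dvdz n by rewrite rpredB.
exact: nxy.
Qed.

Definition multiples (n : nat) : subgroup Z := Subgroup (multiples_closed n).

Let coset m n (x : int) : set Z :=
  [set ((x : Z) * y)%g | y in multiples m `&` multiples n].

Lemma coset_eq (m n : nat) (x y : int) : (m %| x)%Z -> (m %| y)%Z ->
  coset m n x = coset m n y <-> (n %| y - x)%Z.
Proof. by move=> mx my; rewrite addrC; exact: lcoset_eq. Qed.

(** The coset of [m * t] only depends on [t] modulo [q]. *)
Lemma index_multiples_le m n q : (0 < q)%N -> (n %| m * q)%N ->
  finite_index (multiples m) (multiples m `&` multiples n) /\
  (subgroup_index (multiples m) (multiples m `&` multiples n) <= q)%N.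
Proof.
move=> q_gt0 n_mq.
pose r := [seq coset m n (m * k)%N | k <- iota 0 q].
have sub C : left_cosets (multiples m) (multiples m `&` multiples n) C ->
    C \in r.
  case=> x /= mx <-; have /dvdzP[t xE] := mx.
  apply/mapP; exists `|(t %% q)%Z|%N.
    rewrite mem_iota add0n -ltz_nat gez0_abs ?modz_ge0 ?ltz_pmod//.
    by rewrite eqz_nat -lt0n.
  apply/coset_eq => //; first by rewrite PoszM dvdz_mulr.
  rewrite PoszM gez0_abs ?modz_ge0 ?eqz_nat -?lt0n//.
  have -> : m%:Z * (t %% q)%Z - x = - ((t %/ q)%Z * (m * q)%N%:Z).
    by rewrite xE {2}(divz_eq t q) PoszM; ring.
  by rewrite rpredN; apply: dvdz_mull.
have fin : finite_index (multiples m) (multiples m `&` multiples n).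
  apply: (sub_finite_set _ (finite_seq r)) => C /sub; exact.
split=> //; rewrite /subgroup_index -[q](size_iota 0).
rewrite -(size_map (fun k => coset m n (m * k)%N)).
apply: uniq_leq_size; first exact: fset_uniq.
by move=> C; rewrite in_fset_set// inE => /sub.
Qed.

(** Pigeonhole on the cosets of [m * 0], ..., [m * D]. *)
Lemma index_multiples_ge m n D :
  finite_index (multiples m) (multiples m `&` multiples n) ->
  (subgroup_index (multiples m) (multiples m `&` multiples n) <= D)%N ->
  exists2 s, (0 < s <= D)%N & (n %| s * m)%N.
Proof.
move=> fin leD; pose r := [seq coset m n (m * k)%N | k <- iota 0 D.+1].
have : ~~ uniq r.
  apply/negP => r_uniq; suff : (D < D)%N by rewrite ltnn.
  apply: leq_trans leD; rewrite -[D.+1](size_iota 0).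
  rewrite -(size_map (fun k => coset m n (m * k)%N)).
  apply: uniq_leq_size => // _ /mapP[k _ ->].
  rewrite in_fset_set// inE; exists ((m * k)%N%:Z : Z) => //=.
  by rewrite PoszM dvdz_mulr.
case/(uniqPn set0) => i [j [ij]]; rewrite size_map size_iota => jD.
rewrite !(nth_map 0%N) ?size_iota ?(ltn_trans ij)// !nth_iota ?(ltn_trans ij)//.
rewrite !add0n => /coset_eq.
rewrite !PoszM !dvdz_mulr// => /(_ erefl erefl).
rewrite -!PoszM subzn ?leq_mul2l ?(ltnW ij) ?orbT// -mulnBr => H.
by exists (j - i)%N; [lia|rewrite mulnC].
Qed.
End IntegerSubgroups.

(** * Integers with prescribed prime exponents *)

Lemma distinct_primes (I : finType) :
  exists2 p : I -> nat, injective p & forall i, prime (p i).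
Proof.
pose q k := iter k (fun m => s2val (prime_above m)) 2%N.
have q_prime k : prime (q k) by case: k => //= k; case: prime_above.
have q_lt k l : (k < l)%N -> (q k < q l)%N.
  elim: l => // l IH; rewrite ltnS leq_eqVlt => /predU1P[->|/IH /ltn_trans].
    by rewrite /q /=; case: prime_above.
  by apply; rewrite /q /=; case: prime_above.
exists (fun i => q (enum_rank i)) => // i j E.
apply/enum_rank_inj/val_inj => /=.
by case: (ltngtP (enum_rank i) (enum_rank j)) => // /q_lt; rewrite E ltnn.
Qed.

Section PrimeExponents.
Local Open Scope nat_scope.
Variables (I : finType) (p : I -> nat).
Hypotheses (p_inj : injective p) (p_prime : forall i, prime (p i)).

Definition of_exponents (x : I -> nat) : nat := \prod_i p i ^ x i.

Lemma of_exponents_gt0 x : 0 < of_exponents x.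
Proof. by rewrite prodn_gt0// => i; rewrite expn_gt0 prime_gt0. Qed.

Lemma logn_of_exponents x i : logn (p i) (of_exponents x) = x i.
Proof.
rewrite /of_exponents (bigD1 i)//= lognM; last 2 first.
- by rewrite expn_gt0 prime_gt0.
- by rewrite prodn_gt0// => j; rewrite expn_gt0 prime_gt0.
rewrite lognX logn_prime// eqxx muln1 logn_coprime ?addn0//.
elim/big_ind: _ => [|u v|j jNi]; first exact: coprimen1.
  by rewrite coprimeMr => -> ->.
apply: coprimeXr.
by rewrite prime_coprime// dvdn_prime2//; apply: contra jNi => /eqP/p_inj ->.
Qed.

Lemma of_exponents_dvd k x z : (forall i, z i <= x i + k) ->
  of_exponents z %| of_exponents x * of_exponents (fun=> k).
Proof.
move=> zx; rewrite /of_exponents -big_split /=.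
apply: (big_ind2 (fun u v => u %| v)) => // [*|i _]; first exact: dvdn_mul.
by rewrite -expnD dvdn_exp2l.
Qed.

(** The crude bound of the valuation of [s] by [s] itself is enough, since only
    boundedness matters. *)
Lemma leq_exponent D s x z : 0 < s <= D ->
  of_exponents x %| s * of_exponents z -> forall i, x i <= z i + D.
Proof.
move=> /andP[s_gt0 sD] xz i; rewrite -(logn_of_exponents x i).
apply: (leq_trans (dvdn_leq_log (p i) _ xz)).
  by rewrite muln_gt0 s_gt0 of_exponents_gt0.
rewrite lognM ?of_exponents_gt0// logn_of_exponents addnC leq_add2l.
by apply: ltnW; apply: leq_trans sD; exact: ltn_logl.
Qed.

End PrimeExponents.

(** * The logarithmic distance between subgroups of the integers *)

Section Distance.
Variables (R : realType) (b : R).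
Hypothesis b_gt1 : 1 < b.
Notation Z := (GRing.to_multiplicative int).
Notation d := (@subgroup_dist R b Z).

Lemma dist_multiples_le m n q : (0 < q)%N -> (n %| m * q)%N -> (m %| n * q)%N ->
  (d (multiples m) (multiples n) <= (ln q%:R / ln b)%:E)%E.
Proof.
move=> q_gt0 n_mq m_nq; have lnb : 0 < ln b by rewrite ln_gt0.
have [finm lem] := @index_multiples_le m n q q_gt0 n_mq.
have [finn len] := @index_multiples_le n m q q_gt0 m_nq.
rewrite classical_sets.setIC in finn len.
rewrite /subgroup_dist asboolT// lee_fin ler_wpM2r ?invr_ge0 ?(ltW lnb)//.
rewrite ler_ln ?posrE ?ltr0n// ?leq_max ?index_gt0// ler_nat.
by rewrite geq_max lem len.
Qed.

(** A distance at most [r] means that the indices are at most [b ^ r], that is,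
    [expR (r * ln b)]. *)
Lemma dist_multiples_ge (r : R) : exists D : nat, forall m n,
  (d (multiples m) (multiples n) <= r%:E)%E ->
  exists2 s, (0 < s <= D)%N & (m %| s * n)%N.
Proof.
exists (Num.bound (expR (r * ln b))) => m n.
rewrite /subgroup_dist; case: asboolP => // -[_ finn].
rewrite lee_fin ler_pdivrMr ?ln_gt0// => le_r.
apply: index_multiples_ge; first by rewrite classical_sets.setIC.
rewrite -(ler_nat R) classical_sets.setIC.
apply: le_trans (ltW (archi_boundP (expR_ge0 _))).
pose H := (multiples m `&` multiples n)%classic.
apply: (@le_trans _ _ (maxn (subgroup_index (multiples m) H)
  (subgroup_index (multiples n) H))%:R).
  by rewrite ler_nat leq_maxr.
by rewrite -ler_ln ?posrE ?expR_gt0 ?expRK// ltr0n leq_max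
  orbC /H classical_sets.setIC index_gt0// classical_sets.setIC.
Qed.

End Distance.

Theorem theorem3p20 (R : realType) (b : R) (b_gt1 : 1 < b) :
  asdim (log_hyperballean (GRing.to_multiplicative int) b_gt1) = +oo%E.
Proof.
rewrite /asdim; case: pselect => // asdim_fin; exfalso.
case: asdim_fin => n /asboolP asdim_n.
have [p p_inj p_prime] := distinct_primes 'I_n.+2.
move: asdim_n; apply: (asdim_gt_of_coarse_embedding
  (log_hyperballean _ b_gt1) n (fun x => multiples (of_exponents _ p x))).
- move=> k; set q := of_exponents _ p (fun=> k).
  have q_gt0 : (0 < q)%N by exact: of_exponents_gt0.
  have r_ge0 : 0 <= ln q%:R / ln b :> R.
    by rewrite divr_ge0 ?ln_ge0 ?ler1n// ltW.
  exists (NngNum r_ge0) => x z xz zx.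
  by apply: dist_multiples_le => //; exact: of_exponents_dvd.
- move=> r; have [D HD] := dist_multiples_ge R b b_gt1 r%:num.
  exists D => x z xz; have [s sD x_sz] := HD _ _ xz.
  exact: (leq_exponent _ p p_inj p_prime _ _ _ _ sD x_sz).
Qed.
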